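(* Let $(X,\leqslant,\rho)$ be a finite graded poset with minimum and maximum and with a good decomposition $X=A\times B$, and let $f\in[\rho]$ be induced by $g\in[\rho_B]$. If the pair $(g,\rho_B)$ is symmetric, then the pair $(f,\rho)$ is symmetric.
   Context: Let $(X,\leqslant,\rho)$ be a finite graded poset with minimum $\hat 0$, maximum $\hat 1$ and rank function $\rho$ (with $\rho(\hat 0)=0$). $F(X)$ is the ring of functions $X\to\mathbb{Z}$. Functions $f,g\in F(X)$ are equidistributed if $\sum_{x\in X}q^{f(x)}=\sum_{x\in X}q^{g(x)}$ in $\mathbb{N}[q,q^{-1}]$. Write $f\sim g$ if $f,g$ are equidistributed, $f(\hat 0)=g(\hat 0)$ and $f(\hat 1)=g(\hat 1)$; $[f]$ denotes the $\sim$-equivalence class of $f$ (similarly for other finite graded posets with minimum and maximum). A pair $(f,g)\in F(X)\times F(X)$ is symmetric if $\sum_{x\in X}q^{f(x)}t^{g(x)}=\sum_{x\in X}q^{g(x)}t^{f(x)}$ in $\mathbb{N}[q,t,q^{-1},t^{-1}]$ (and similarly for pairs in $F(B)\times F(B)$). Decompositions: suppose the underlying set of $X$ is (in bijection with) a cartesian product $A\times B$, with projections $\pi_A,\pi_B$. The sets $A$ and $B$ carry the partial orders induced from $\leqslant$ on $X$, for which all inclusions $a\mapsto(a,b)$ ($b\in B$ fixed) and $b\mapsto(a,b)$ ($a\in A$ fixed) are order preserving (so the order on $X$ is a refinement of the product order; $\pi_A,\pi_B$ need not be order preserving), and $\hat 0=(\hat 0_A,\hat 0_B)$, $\hat 1=(\hat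 1_A,\hat 1_B)$, where $\hat 0_A,\hat 1_A$ (resp. $\hat 0_B,\hat 1_B$) are the minimum and maximum of $A$ (resp. $B$). Put $\rho_A(a)=\rho(a,\hat 0_B)$ and $\rho_B(b)=\rho(\hat 0_A,b)$. The decomposition is good if $(A,\leqslant,\rho_A)$ and $(B,\leqslant,\rho_B)$ are graded posets (with rank functions $\rho_A,\rho_B$) and $\rho=\rho_A\circ\pi_A+\rho_B\circ\pi_B$. For a good decomposition, put $R(f)=f-\rho_A\circ\pi_A$ for $f\in F(X)$. A function $f\in[\rho]$ is induced by $g\in F(B)$ if $g\in[\rho_B]$ and $R(f)=g\circ\pi_B$. *)

(* Defs.v *)
From HB Require Import structures.
From mathcomp Require Import all_boot all_order all_algebra.

Set Implicit Arguments.
Unset Strict Implicit.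
Unset Printing Implicit Defensive.

Import Order.TTheory GRing.Theory Num.Theory.

Local Open Scope ring_scope.

Definition covers d (P : finTBPOrderType d) (x y : P) : bool :=
  (x < y)%O && ~~ [exists z : P, (x < z < y)%O].

Definition is_rank_function d (P : finTBPOrderType d)
    (rho : {ffun P -> int}) : Prop :=
  rho \bot%O = 0 /\ forall x y : P, covers x y -> rho y = rho x + 1.

(* The Laurent polynomial semiring N[q, q^-1] is embedded in the fraction
   field of Z[q], and N[q, t, q^-1, t^-1] in the fraction field of Z[q][t];
   the exponents below are signed integers. *)
Definition laurent_q : {fraction {poly int}} := tofrac 'X.

Definition laurent2_q : {fraction {poly {poly int}}} := tofrac ('X%:P).
Definition laurent2_t : {fraction {poly {poly int}}} := tofrac 'X.

Definition equidistributed (T : finType) (f g : {ffun T -> int}) : Prop :=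
  \sum_(x : T) laurent_q ^ f x = \sum_(x : T) laurent_q ^ g x.

Definition symmetric_pair (T : finType) (f g : {ffun T -> int}) : Prop :=
  \sum_(x : T) laurent2_q ^ f x * laurent2_t ^ g x =
  \sum_(x : T) laurent2_q ^ g x * laurent2_t ^ f x.

(* [sim f g] says that [f] and [g] have the same class. *)
Definition sim d (P : finTBPOrderType d) (f g : {ffun P -> int}) : Prop :=
  [/\ equidistributed f g, f \bot%O = g \bot%O & f \top%O = g \top%O].

(* [dec_leA] and [dec_leB] make the order of each factor the one induced from
   [X]: the largest order for which all the inclusions [fun a => dec_pair a b]
   (resp. [fun b => dec_pair a b]) are order preserving. When the inclusions
   preserve the order of the slice through the minimum of the other factor,
   it is the order of that slice. *)
Record decomposition dX (X : finTBPOrderType dX)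
    dA (A : finTBPOrderType dA) dB (B : finTBPOrderType dB) := Decomposition {
  dec_pair : A -> B -> X;
  dec_projA : X -> A;
  dec_projB : X -> B;
  dec_projAK : forall a b, dec_projA (dec_pair a b) = a;
  dec_projBK : forall a b, dec_projB (dec_pair a b) = b;
  dec_pairK : forall x, dec_pair (dec_projA x) (dec_projB x) = x;
  dec_leA : forall a a' : A,
    (a <= a')%O <-> forall b, (dec_pair a b <= dec_pair a' b)%O;
  dec_leB : forall b b' : B,
    (b <= b')%O <-> forall a, (dec_pair a b <= dec_pair a b')%O;
  dec_bot : dec_pair \bot%O \bot%O = \bot%O;
  dec_top : dec_pair \top%O \top%O = \top%O
}.

Definition rankA dX (X : finTBPOrderType dX) dA (A : finTBPOrderType dA)
    dB (B : finTBPOrderType dB) (D : decomposition X A B)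
    (rho : {ffun X -> int}) : {ffun A -> int} :=
  [ffun a => rho (dec_pair D a \bot%O)].

Definition rankB dX (X : finTBPOrderType dX) dA (A : finTBPOrderType dA)
    dB (B : finTBPOrderType dB) (D : decomposition X A B)
    (rho : {ffun X -> int}) : {ffun B -> int} :=
  [ffun b => rho (dec_pair D \bot%O b)].

Definition good_decomposition dX (X : finTBPOrderType dX)
    dA (A : finTBPOrderType dA) dB (B : finTBPOrderType dB)
    (D : decomposition X A B) (rho : {ffun X -> int}) : Prop :=
  [/\ is_rank_function (rankA D rho),
      is_rank_function (rankB D rho) &
      rho = [ffun x => rankA D rho (dec_projA D x)]
            + [ffun x => rankB D rho (dec_projB D x)]].

Definition Rmap dX (X : finTBPOrderType dX)
    dA (A : finTBPOrderType dA) dB (B : finTBPOrderType dB)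
    (D : decomposition X A B) (rho f : {ffun X -> int}) : {ffun X -> int} :=
  f - [ffun x => rankA D rho (dec_projA D x)].

Definition induced_by dX (X : finTBPOrderType dX)
    dA (A : finTBPOrderType dA) dB (B : finTBPOrderType dB)
    (D : decomposition X A B) (rho f : {ffun X -> int})
    (g : {ffun B -> int}) : Prop :=
  sim g (rankB D rho) /\ Rmap D rho f = [ffun x => g (dec_projB D x)].

(* Main.v *)
Require Import Defs.
From mathcomp Require Import all_boot all_order all_algebra.

Set Implicit Arguments.
Unset Strict Implicit.
Unset Printing Implicit Defensive.

Import GRing.Theory.
Local Open Scope ring_scope.

(** On a good decomposition, both [f] and [rho] are the sum of the same
    function [rankA] of the first coordinate and of a function of the second
    one: [g] for [f], and [rankB] for [rho].  Hence the joint generating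
    function of [(f, rho)] factors as

      (\sum_a (q t)^(rankA a)) * (\sum_b q^(g b) t^(rankB b)),

    and that of [(rho, f)] has the same first factor, with the exponents
    exchanged in the second one ([joint_sum_factor]).  The first factor is
    symmetric in [q] and [t], so the symmetry of [(g, rankB)] is all that
    remains. *)

Lemma laurent2_q_neq0 : laurent2_q != 0.
Proof. by rewrite tofrac_eq0 polyC_eq0 polyX_eq0. Qed.

Lemma laurent2_t_neq0 : laurent2_t != 0.
Proof. by rewrite tofrac_eq0 polyX_eq0. Qed.

Section JointSum.

Variables (dX dA dB : Order.disp_t).
Variables (X : finTBPOrderType dX) (A : finTBPOrderType dA).
Variables (B : finTBPOrderType dB) (D : decomposition X A B).

Lemma sum_decomposition (V : nmodType) (F : X -> V) :
  \sum_x F x = \sum_a \sum_b F (dec_pair D a b).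
Proof.
rewrite pair_big /=.
rewrite (reindex (fun p : A * B => dec_pair D p.1 p.2)) //=.
exists (fun x => (dec_projA D x, dec_projB D x)) => [[a b] _ | x _] /=.
  by rewrite dec_projAK dec_projBK.
exact: dec_pairK.
Qed.

(** The two statistics share the summand [r], so each term contributes
    [(q * t) ^ r a], which does not see [b] and separates from the rest. *)
Lemma joint_sum_factor (K : fieldType) (q t : K) (f h : X -> int)
    (r : A -> int) (u v : B -> int) :
    q != 0 -> t != 0 ->
    (forall a b, f (dec_pair D a b) = r a + u b) ->
    (forall a b, h (dec_pair D a b) = r a + v b) ->
  \sum_x q ^ f x * t ^ h x =
  (\sum_a (q * t) ^ r a) * (\sum_b q ^ u b * t ^ v b).
Proof.
move=> q0 t0 fE hE; rewrite sum_decomposition big_distrlr /=.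
apply: eq_bigr => a _; apply: eq_bigr => b _.
by rewrite fE hE !expfzDr // expfzMl mulrACA.
Qed.

End JointSum.

Theorem theorem3p13
    (dX : Order.disp_t) (X : finTBPOrderType dX)
    (dA : Order.disp_t) (A : finTBPOrderType dA)
    (dB : Order.disp_t) (B : finTBPOrderType dB)
    (rho : {ffun X -> int}) (rho_rank : is_rank_function rho)
    (D : decomposition X A B) (goodD : good_decomposition D rho)
    (f : {ffun X -> int}) (f_class : sim f rho)
    (g : {ffun B -> int}) (fg_induced : induced_by D rho f g)
    (g_sym : symmetric_pair g (rankB D rho)) :
  symmetric_pair f rho.
Proof.
case: goodD => _ _ rhoD; case: fg_induced => _ fR.
have rhoE a b : rho (dec_pair D a b) = rankA D rho a + rankB D rho b.
  by rewrite {1}rhoD ffunE [X in X + _]ffunE [X in _ + X]ffunE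
    dec_projAK dec_projBK.
have fE a b : f (dec_pair D a b) = rankA D rho a + g b.
  move/ffunP/(_ (dec_pair D a b)): fR.
  rewrite /Rmap ffunE [RHS]ffunE [X in _ + X]ffunE [X in - X]ffunE.
  by rewrite dec_projAK dec_projBK => <-; rewrite addrC subrK.
have [q0 t0] := (laurent2_q_neq0, laurent2_t_neq0).
rewrite /symmetric_pair (joint_sum_factor q0 t0 fE rhoE).
by rewrite (joint_sum_factor q0 t0 rhoE fE) g_sym.
Qed.
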